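(* Let $(A,d,\nu)$ be a dg-algebra with a deformation retract onto its homology $(H_*(A),0)$: chain maps $p:A\to H_*(A)$, $i:H_*(A)\to A$ and a homotopy $h:A\to A$ of degree $+1$ with $pi=\mathrm{id}$, $\mathrm{id}-ip=dh+hd$, $h^2=0$, $ph=0$, $hi=0$. Let $\chi_2:=\nu$ and $\chi_n:=(-1)^{n-1}\chi_{n-1}h_{n-1}\nu_n$ for $n\ge3$. Then for all $n\ge3$ and all maps $f_1,\dots,f_n$, each of which is either equal to $i:H_*(A)\to A$ or of the form $h\circ f:B\to A$ with $B$ an arbitrary graded vector space and $f:B\to A$ an arbitrary graded linear map, \[ \chi_n\circ(f_1\otimes\dots\otimes f_n)=\Big[\sum_{\substack{k+l=n\\k,l\ge2}}(-1)^{k(l+1)}\nu\big(h\chi_k\otimes h\chi_l(ip)^{\otimes l}\big)+(-1)^{n-1}\nu(\mathrm{id}\otimes h\chi_{n-1})-\nu(h\chi_{n-1}\otimes ip)\Big]\circ(f_1\otimes\dots\otimes f_n). \]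
   Context: Graded vector spaces are $\mathbb Z$-graded over a field $k$; tensor products of graded maps use the Koszul sign convention $(f\otimes g)(v\otimes w)=(-1)^{|g||v|}f(v)\otimes g(w)$. A dg-algebra $(A,d,\nu)$ is a graded associative unital algebra with product $\nu$ of degree $0$ and $d$ of degree $-1$ with $d^2=0$, $d\nu=\nu(d\otimes\mathrm{id}+\mathrm{id}\otimes d)$. Notation: $h_n=\sum_{r+t=n-1}\mathrm{id}^{\otimes r}\otimes h\otimes(ip)^{\otimes t}:A^{\otimes n}\to A^{\otimes n}$ for $n\ge1$; $\nu_n=\sum_{r+t=n-2}(-1)^t\,\mathrm{id}^{\otimes r}\otimes\nu\otimes\mathrm{id}^{\otimes t}:A^{\otimes n}\to A^{\otimes n-1}$ for $n\ge2$. *)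

(* Defs.v *)
From HB Require Import structures.
From mathcomp Require Import all_boot all_order all_algebra.
From mathcomp.classical Require Import boolp classical_sets functions.
From mathcomp.classical Require Import cardinality fsbigop.
From mathcomp Require Import freeg.

Set Implicit Arguments.
Unset Strict Implicit.
Unset Printing Implicit Defensive.

Import GRing.Theory.
Local Open Scope ring_scope.
Local Open Scope quotient_scope.

Section Span.
Variables (k : fieldType) (V : lmodType k).

Definition submodule (P : set V) : Prop :=
  P 0 /\ forall (c : k) x y, P x -> P y -> P (c *: x + y).

Definition lin_span (S : set V) : set V :=
  [set x | forall P, submodule P -> (S `<=` P)%classic -> P x].

Lemma lin_span_sub (S : set V) : (S `<=` lin_span S)%classic.
Proof. by move=> x Sx P _; apply. Qed.

Lemma submodule_lin_span (S : set V) : submodule (lin_span S).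
Proof.
split=> [P [P0 _] _ //|c x y Sx Sy P HP SP].
by apply: HP.2; [exact: Sx|exact: Sy].
Qed.

Definition spanb (S : set V) : {pred V} := fun x => `[< lin_span S x >].

Lemma spanb_submod (S : set V) : submod_closed (spanb S).
Proof.
have [H0 HD] := submodule_lin_span S.
split=> [|c x y /asboolP Sx /asboolP Sy]; first exact/asboolP.
by apply/asboolP; exact: HD.
Qed.

HB.instance Definition _ S := GRing.isSubmodClosed.Build k V (spanb S)
  (spanb_submod S).

Definition lquot (S : set V) : Type := Quotient.quot (spanb S).
HB.instance Definition _ S := GRing.Zmodule.on (lquot S).
HB.instance Definition _ S := @Quotient.on (lquot S).

Definition lproj (S : set V) (x : V) : lquot S := \pi_(Quotient.quot (spanb S)) x.

Lemma lproj_surj S (q : lquot S) : exists x, lproj S x = q.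
Proof. by exists (repr q); rewrite /lproj reprK. Qed.

Lemma lproj_eq S x y : lproj S x = lproj S y <-> lin_span S (x - y).
Proof.
have E := Quotient.idealrBE (spanb S) x y.
by split=> [/eqP /(etrans E) /asboolP|/asboolP /(etrans (esym E)) /eqP].
Qed.

Lemma lprojD S : {morph lproj S : x y / x + y}.
Proof. by move=> x y; rewrite /lproj; apply/esym; exact: (esym (Quotient.pi_add _ _ _)). Qed.

Definition lquot_scale S (c : k) (q : lquot S) : lquot S := lproj S (c *: repr q).

Lemma lprojZ S c x : lproj S (c *: x) = lquot_scale c (lproj S x).
Proof.
apply/lproj_eq; rewrite -scalerBr -[_ *: _]addr0.
have [H0 HD] := submodule_lin_span S.
by apply: HD => //; apply/lproj_eq; rewrite {2}/lproj reprK.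
Qed.

Lemma lquot_scaleA S a b (q : lquot S) :
  lquot_scale a (lquot_scale b q) = lquot_scale (a * b) q.
Proof. by have [x <-] := lproj_surj q; rewrite -!lprojZ scalerA. Qed.

Lemma lquot_scale1 S (q : lquot S) : lquot_scale 1 q = q.
Proof. by have [x <-] := lproj_surj q; rewrite -!lprojZ scale1r. Qed.

Lemma lquot_scaleDr S : right_distributive (@lquot_scale S) +%R.
Proof.
move=> a p q; have [x <-] := lproj_surj p; have [y <-] := lproj_surj q.
by rewrite -lprojD -!lprojZ scalerDr lprojD.
Qed.

Lemma lquot_scaleDl S (q : lquot S) :
  {morph (@lquot_scale S)^~ q : a b / a + b}.
Proof.
move=> a b; have [x <-] := lproj_surj q.
by rewrite -!lprojZ scalerDl lprojD.
Qed.

HB.instance Definition _ S := GRing.Zmodule_isLmodule.Build k (lquot S)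
  (@lquot_scaleA S) (@lquot_scale1 S) (@lquot_scaleDr S) (@lquot_scaleDl S).

Lemma lproj_linear S : linear (lproj S).
Proof. by move=> c x y; rewrite lprojD lprojZ. Qed.
HB.instance Definition _ S :=
  GRing.isLinear.Build k V (lquot S) *:%R (lproj S) (@lproj_linear S).

(* The map induced on the quotient by a map that vanishes on [S]. *)
Definition lquot_lift (W : lmodType k) S (f : V -> W) (q : lquot S) : W :=
  f (repr q).

Lemma lquot_liftE (W : lmodType k) S (f : {linear V -> W}) x :
  (forall s, S s -> f s = 0) -> lquot_lift f (lproj S x) = f x.
Proof.
move=> fS; apply/eqP; rewrite -subr_eq0 -linearB; apply/eqP.
have : lin_span S (repr (lproj S x) - x).
  by apply/lproj_eq; rewrite {1}/lproj reprK.
move=> /(_ [set u | f u = 0]%classic) /= Hx; apply: Hx => [|s]; last exact: fS.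
split; first exact: linear0.
by move=> c u v /= fu fv; rewrite linearP fu fv scaler0 addr0.
Qed.

Lemma lquot_lift_linear (W : lmodType k) S (f : {linear V -> W}) :
  (forall s, S s -> f s = 0) -> linear (@lquot_lift W S f).
Proof.
move=> fS c p q; have [x <-] := lproj_surj p; have [y <-] := lproj_surj q.
by rewrite -linearP !lquot_liftE // linearP.
Qed.
End Span.


Section FreeLift.
Variables (k : fieldType) (K : choiceType) (W : lmodType k) (f : K -> W).

Lemma fglift_linear : linear (fglift f : {freeg K / k} -> W).
Proof.
have fgB : {morph fglift f : x y / x - y} := lift_is_additive f.
have fg0 : fglift f (0 : {freeg K / k}) = 0 by rewrite -{1}(subrr 0) fgB subrr.
have fgN : {morph fglift f : x / - x} by move=> x; rewrite -sub0r fgB fg0 sub0r.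
have fgD : {morph fglift f : x y / x + y}.
  by move=> x y; rewrite -{1}[y]opprK fgB fgN opprK.
move=> c x y; rewrite fgD; congr (_ + _).
have fgs (g : K -> k) (s : seq K) :
    fglift f (\sum_(z <- s) << g z *g z >>) = \sum_(z <- s) g z *: f z.
  rewrite (big_morph _ fgD fg0); apply: eq_bigr => z _; exact: liftU.
have -> : fglift f x = \sum_(z <- dom x) coeff z x *: f z.
  by rewrite -fgs freeg_sumE.
rewrite scaler_sumr [LHS]fgs.
by apply: eq_bigr => z _; rewrite scalerA.
Qed.

HB.instance Definition _ :=
  GRing.isLinear.Build k {freeg K / k} W *:%R (fglift f) fglift_linear.
End FreeLift.

Definition bilin (k : fieldType) (V W X : lmodType k) (b : V -> W -> X) : Prop :=
  (forall w, linear (b^~ w)) /\ (forall v, linear (b v)).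

Section Tensor.
Variables (k : fieldType) (V W : lmodType k).

Definition tens_rel : set {freeg (V * W)%type / k} := [set r |
  (exists c v v' w,
     r = << (c *: v + v', w) >> - c *: << (v, w) >> - << (v', w) >>) \/
  (exists c v w w',
     r = << (v, c *: w + w') >> - c *: << (v, w) >> - << (v, w') >>)].

Definition tens : lmodType k := lquot tens_rel.

Definition tpure (v : V) (w : W) : tens := lproj tens_rel << (v, w) >>.

Lemma tpure_linearl w : linear (tpure^~ w).
Proof.
move=> c v v'; apply/eqP; rewrite -subr_eq0 /tpure -linearP -linearB.
rewrite -(linear0 (lproj tens_rel)); apply/eqP/lproj_eq; rewrite subr0 opprD addrA.
by apply: lin_span_sub; left; exists c, v, v', w.
Qed.

Lemma tpure_linearr v : linear (tpure v).
Proof.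
move=> c w w'; apply/eqP; rewrite -subr_eq0 /tpure -linearP -linearB.
rewrite -(linear0 (lproj tens_rel)); apply/eqP/lproj_eq; rewrite subr0 opprD addrA.
by apply: lin_span_sub; right; exists c, v, w, w'.
Qed.

Definition tpurel w v := tpure v w.
HB.instance Definition _ w :=
  GRing.isLinear.Build k V tens *:%R (tpurel w) (tpure_linearl w).
HB.instance Definition _ v :=
  GRing.isLinear.Build k W tens *:%R (tpure v) (tpure_linearr v).

Lemma tpure_suml (I : Type) (s : seq I) (P : pred I) (F : I -> V) w :
  tpure (\sum_(j <- s | P j) F j) w = \sum_(j <- s | P j) tpure (F j) w.
Proof. exact: (linear_sum (tpurel w)). Qed.
Lemma tpure_sumr (I : Type) (s : seq I) (P : pred I) (F : I -> W) v :
  tpure v (\sum_(j <- s | P j) F j) = \sum_(j <- s | P j) tpure v (F j).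
Proof. exact: linear_sum. Qed.
Lemma tpureZl c v w : tpure (c *: v) w = c *: tpure v w.
Proof. exact: (linearZZ (tpurel w)). Qed.
Lemma tpureZr c v w : tpure v (c *: w) = c *: tpure v w.
Proof. exact: linearZZ. Qed.
Lemma tpure0l w : tpure 0 w = 0. Proof. exact: (linear0 (tpurel w)). Qed.
Lemma tpure0r v : tpure v 0 = 0. Proof. exact: linear0. Qed.

Lemma tens_ind (P : tens -> Prop) :
  P 0 -> (forall s t, P s -> P t -> P (s + t)) ->
  (forall v w, P (tpure v w)) -> forall t, P t.
Proof.
move=> P0 PD Pp t; have [x <-] := lproj_surj t.
rewrite -(freeg_sumE x) linear_sum.
apply: (big_ind P) => // -[v w] _.
suff -> : << coeff (v, w) x *g (v, w) >> = coeff (v, w) x *: << (v, w) >>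
    :> {freeg (V * W)%type / k}.
  by rewrite linearZZ -/(tpure v w) -tpureZl.
by apply/eqP/freeg_eqP => y; rewrite coeffZ !coeffU mul1r.
Qed.

Definition tlift (X : lmodType k) (b : V -> W -> X) : tens -> X :=
  lquot_lift (fglift (fun p => b p.1 p.2)).

Section Lift.
Variables (X : lmodType k) (b : V -> W -> X).
Hypothesis bP : bilin b.

Let b_rel r : tens_rel r -> fglift (fun p => b p.1 p.2) r = 0.
Proof.
have fgU p : fglift (fun p => b p.1 p.2) << p >> = b p.1 p.2.
  by rewrite liftU scale1r.
case=> -[c] [v] [v'] [w] ->; rewrite !linearB linearZ /= !fgU /=.
  by rewrite (bP.1 w) -addrA -opprD subrr.
by rewrite (bP.2 v) -addrA -opprD subrr.
Qed.

Lemma tliftE v w : tlift b (tpure v w) = b v w.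
Proof.
rewrite /tlift /tpure (lquot_liftE _ b_rel).
by rewrite [LHS]liftU scale1r.
Qed.

Lemma tlift_linear : linear (tlift b).
Proof. exact: lquot_lift_linear b_rel. Qed.
End Lift.

End Tensor.


Section Graded.
Variable k : fieldType.

(* A Z-graded vector space, given as its total space (the direct sum of its
   homogeneous components) together with the projections onto the components:
   [gpr n] is the projection onto the component of degree [n]. *)
Record gspace := GSpace {
  gcar :> lmodType k;
  gpr : int -> gcar -> gcar;
  gpr_linear : forall n, linear (gpr n);
  gpr_pr : forall m n v, gpr m (gpr n v) = if m == n then gpr n v else 0;
  gpr_dec : forall v, exists2 s : seq int, uniq s & v = \sum_(n <- s) gpr n v
}.

HB.instance Definition _ (V : gspace) n :=
  GRing.isLinear.Build k V V *:%R (@gpr V n) (gpr_linear n).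

Definition homog (V : gspace) (n : int) (v : V) : Prop := gpr n v = v.

Lemma homog_gpr (V : gspace) n (v : V) : homog n (gpr n v).
Proof. by rewrite /homog gpr_pr eqxx. Qed.

Lemma gpr_homog (V : gspace) m n (v : V) :
  homog n v -> gpr m v = if m == n then v else 0.
Proof. by move=> <-; rewrite gpr_pr. Qed.

Lemma gpr_supp (V : gspace) (v : V) : exists s : seq int,
  [/\ uniq s, forall n, n \notin s -> gpr n v = 0 & v = \sum_(n <- s) gpr n v].
Proof.
have [s us vE] := gpr_dec v; exists s; split=> // n ns.
rewrite vE linear_sum big_seq big1 // => m ms /=.
by rewrite gpr_pr; case: eqP ns => // ->; rewrite ms.
Qed.

Lemma gspace_ind (V : gspace) (P : V -> Prop) :
  P 0 -> (forall u v, P u -> P v -> P (u + v)) ->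
  (forall n v, homog n v -> P v) -> forall v, P v.
Proof.
move=> P0 PD Ph v; have [s _ ->] := gpr_dec v.
by apply: (big_ind P) => // n _; apply: (Ph n); exact: homog_gpr.
Qed.

Lemma fsum_seq (V : lmodType k) (s : seq int) (F : int -> V) :
  uniq s -> (forall n, n \notin s -> F n = 0) ->
  \sum_(n \in [set: int]) F n = \sum_(n <- s) F n.
Proof.
move=> us F0; rewrite (fsbigE s) //; last by move=> n _; exact: F0.
by apply: eq_bigl => n; rewrite in_setT.
Qed.

(* Multiplication by (-1)^(e n) on the component of degree n. *)
Definition ksgn (V : gspace) (e : int) (v : V) : V :=
  \sum_(n \in [set: int]) (-1) ^ (e * n) *: gpr n v.

Lemma ksgn_linear (V : gspace) e : linear (@ksgn V e).
Proof.
move=> c u v; have [s [_ s0 _]] := gpr_supp u; have [t [_ t0 _]] := gpr_supp v.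
pose r := undup (s ++ t).
have ru n : n \notin r -> gpr n u = 0.
  by rewrite mem_undup mem_cat negb_or => /andP[/s0].
have rv n : n \notin r -> gpr n v = 0.
  by rewrite mem_undup mem_cat negb_or => /andP[_ /t0].
have E w : (forall n, n \notin r -> gpr n w = 0) ->
    ksgn e w = \sum_(n <- r) (-1) ^ (e * n) *: gpr n w.
  move=> rw; apply: fsum_seq; first exact: undup_uniq.
  by move=> n /rw ->; rewrite scaler0.
rewrite !E // => [|n nr]; last by rewrite linearP /= ru // rv // scaler0 addr0.
rewrite scaler_sumr -big_split; apply: eq_bigr => n _ /=.
by rewrite linearP scalerDr !scalerA mulrC.
Qed.
HB.instance Definition _ (V : gspace) e :=
  GRing.isLinear.Build k V V *:%R (@ksgn V e) (ksgn_linear e).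

Lemma ksgnE (V : gspace) e n (v : V) :
  homog n v -> ksgn e v = (-1) ^ (e * n) *: v.
Proof.
move=> hv; rewrite /ksgn (@fsum_seq _ [:: n]) //.
  by rewrite big_seq1 hv.
by move=> m; rewrite inE (gpr_homog _ hv) => /negbTE ->; rewrite scaler0.
Qed.

(* A graded linear map, together with its degree. *)
Record gmap (V W : gspace) := GMap {
  gfun :> V -> W;
  gdeg : int;
  gfun_linear : linear gfun;
  gfun_homog : forall n v, homog n v -> homog (n + gdeg) (gfun v)
}.
HB.instance Definition _ (V W : gspace) (f : gmap V W) :=
  GRing.isLinear.Build k V W *:%R (gfun f) (gfun_linear f).

Lemma gpr_gfun (V W : gspace) (f : gmap V W) n v :
  gpr (n + gdeg f) (f v) = f (gpr n v).
Proof.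
move: v; apply: gspace_ind => [|u v Hu Hv|m v hv]; first by rewrite !linear0.
  by rewrite !linearD /= Hu Hv.
rewrite (gpr_homog _ (gfun_homog f hv)) (gpr_homog _ hv).
by rewrite (inj_eq (addIr _)); case: ifP => _ //; rewrite linear0.
Qed.

Definition gid_subproof (V : gspace) n (v : V) : homog n v -> homog (n + 0) v.
Proof. by rewrite addr0. Qed.
Definition gid (V : gspace) : gmap V V :=
  @GMap V V (fun v => v) 0 (fun _ _ _ => erefl) (@gid_subproof V).

Lemma gzero_homog (V W : gspace) n (v : V) : homog n v -> homog (n + 0) (0 : W).
Proof. by move=> _; rewrite /homog linear0. Qed.
Lemma gzero_linear (V W : gspace) : linear (fun _ : V => 0 : W).
Proof. by move=> c u v; rewrite scaler0 addr0. Qed.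
Definition gzero (V W : gspace) : gmap V W :=
  GMap (@gzero_linear V W) (@gzero_homog V W).

Section Comp.
Variables (U V W : gspace) (g : gmap V W) (f : gmap U V).
Lemma gcomp_linear : linear (g \o f).
Proof. by move=> c u v /=; rewrite !linearP. Qed.
Lemma gcomp_homog n u : homog n u -> homog (n + (gdeg f + gdeg g)) ((g \o f) u).
Proof. by move=> hu; rewrite addrA; do 2 apply: gfun_homog. Qed.
Definition gcomp : gmap U W := GMap gcomp_linear gcomp_homog.
End Comp.

Section Lincomb.
Variables (V W : gspace).

Lemma gscale_linear (c : k) (f : gmap V W) : linear (fun v => c *: f v).
Proof.
by move=> a u v; rewrite linearP scalerDr !scalerA mulrC.
Qed.
Lemma gscale_homog (c : k) (f : gmap V W) n v :
  homog n v -> homog (n + gdeg f) (c *: f v).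
Proof. by move=> /(gfun_homog f); rewrite /homog linearZZ /= => ->. Qed.
Definition gscale c f : gmap V W := GMap (gscale_linear c f) (gscale_homog c f).

Section Sum.
Variables (e : int) (m : nat) (F : 'I_m -> gmap V W).
Hypothesis Fe : forall j, gdeg (F j) = e.
Lemma gsum_linear : linear (fun v => \sum_(j < m) F j v).
Proof.
move=> c u v; rewrite scaler_sumr -big_split.
by apply: eq_bigr => j _ /=; rewrite linearP.
Qed.
Lemma gsum_homog n v : homog n v -> homog (n + e) (\sum_(j < m) F j v).
Proof.
move=> hv; rewrite /homog linear_sum; apply: eq_bigr => j _ /=.
by rewrite -(Fe j); exact: gfun_homog.
Qed.
Definition gsum : gmap V W := GMap gsum_linear gsum_homog.
End Sum.
End Lincomb.

End Graded.

Arguments gid {k V}.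
Arguments gzero {k V W}.
Infix "\oc" := gcomp (at level 50, left associativity) : ring_scope.

Section GradedTensor.
Variable k : fieldType.

(* A tensor product of V and W: an elementary tensor map that is bilinear and
   universal, and a grading for which |v (x) w| = |v| + |w|. *)
Record gtensor (V W : gspace k) := GTensor {
  gt_car : gspace k;
  gt_pure : V -> W -> gt_car;
  gt_lift : forall X : lmodType k, (V -> W -> X) -> gt_car -> X;
  gt_bilin : bilin gt_pure;
  gt_homog : forall a b v w,
    homog a v -> homog b w -> homog (a + b) (gt_pure v w);
  gt_ind : forall P : gt_car -> Prop,
    P 0 -> (forall s t, P s -> P t -> P (s + t)) ->
    (forall v w, P (gt_pure v w)) -> forall t, P t;
  gt_lift_linear : forall (X : lmodType k) (b : V -> W -> X),
    bilin b -> linear (gt_lift b);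
  gt_liftE : forall (X : lmodType k) (b : V -> W -> X),
    bilin b -> forall v w, gt_lift b (gt_pure v w) = b v w
}.

Section Space.
Variables V W : gspace k.

Definition tpr (n : int) : tens V W -> tens V W :=
  tlift (fun v w => \sum_(a \in [set: int]) tpure (gpr a v) (gpr (n - a) w)).

Lemma tpr_bilin n : bilin
  (fun (v : V) (w : W) => \sum_(a \in [set: int]) tpure (gpr a v) (gpr (n - a) w)).
Proof.
have E (v : V) (w : W) s : uniq s -> (forall a, a \notin s -> gpr a v = 0) ->
    \sum_(a \in [set: int]) tpure (gpr a v) (gpr (n - a) w) =
    \sum_(a <- s) tpure (gpr a v) (gpr (n - a) w).
  by move=> us sv; apply: fsum_seq => // a /sv ->; rewrite tpure0l.
split=> [w c u v|v c u w].
  have [s [_ s0 _]] := gpr_supp u; have [t [_ t0 _]] := gpr_supp v.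
  pose r := undup (s ++ t); have ur : uniq r by exact: undup_uniq.
  have ru a : a \notin r -> gpr a u = 0.
    by rewrite mem_undup mem_cat negb_or => /andP[/s0].
  have rv a : a \notin r -> gpr a v = 0.
    by rewrite mem_undup mem_cat negb_or => /andP[_ /t0].
  rewrite !(E _ _ r) // => [|a nr]; last by rewrite linearP /= ru // rv // scaler0 addr0.
  rewrite scaler_sumr -big_split; apply: eq_bigr => a _ /=.
  by rewrite linearP tpure_linearl.
have [s [us s0 _]] := gpr_supp v.
rewrite !(E _ _ s) // scaler_sumr -big_split; apply: eq_bigr => a _ /=.
by rewrite linearP /= linearP.
Qed.

Lemma tpr_linear n : linear (tpr n).
Proof. exact: tlift_linear (tpr_bilin n). Qed.
HB.instance Definition _ n :=
  GRing.isLinear.Build k (tens V W) (tens V W) *:%R (tpr n) (tpr_linear n).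

Lemma tprE n a b v w : homog a v -> homog b w ->
  tpr n (tpure v w) = if n == a + b then tpure v w else 0.
Proof.
move=> hv hw; rewrite /tpr (tliftE (tpr_bilin n)) (@fsum_seq _ _ [:: a]) //.
  rewrite big_seq1 hv (gpr_homog _ hw) subr_eq addrC.
  by case: ifP => _ //; rewrite tpure0r.
move=> c; rewrite inE (gpr_homog _ hv) => /negbTE ->; exact: tpure0l.
Qed.

Lemma tens_hind (P : tens V W -> Prop) :
  P 0 -> (forall s t, P s -> P t -> P (s + t)) ->
  (forall a b v w, homog a v -> homog b w -> P (tpure v w)) -> forall t, P t.
Proof.
move=> P0 PD Ph; apply: tens_ind => // v w.
have [s _ ->] := gpr_dec v; have [r _ ->] := gpr_dec w.
rewrite tpure_suml; apply: (big_ind P) => // a _.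
rewrite tpure_sumr; apply: (big_ind P) => // b _.
by apply: (Ph a b); exact: homog_gpr.
Qed.

Lemma tpr_pr m n t : tpr m (tpr n t) = if m == n then tpr n t else 0.
Proof.
move: t; apply: tens_hind => [|s t Hs Ht|a b v w hv hw].
- by rewrite !linear0 if_same.
- by rewrite !linearD /= Hs Ht; case: ifP; rewrite ?addr0.
rewrite (tprE n hv hw); case: (n =P a + b) => [->|_].
  by rewrite (tprE m hv hw).
by rewrite linear0 if_same.
Qed.

Lemma tpr_dec t : exists2 s : seq int, uniq s & t = \sum_(n <- s) tpr n t.
Proof.
suff [s [us s0 st]] : exists s : seq int,
    [/\ uniq s, forall n, n \notin s -> tpr n t = 0 & t = \sum_(n <- s) tpr n t].
  by exists s.
move: t; apply: tens_hind => [|t u [s [us s0 st]] [r [ur r0 ru]]|a b v w hv hw].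
- by exists [::]; split=> // [n _|]; rewrite ?big_nil ?linear0.
- pose q := undup (s ++ r); exists q; split; first exact: undup_uniq.
    move=> n; rewrite mem_undup mem_cat negb_or => /andP[/s0 nt /r0 nu].
    by rewrite linearD /= nt nu addr0.
  have uq : uniq q by exact: undup_uniq.
  have sum_q (p : seq int) (x : tens V W) : uniq p -> {subset p <= q} ->
      (forall n, n \notin p -> tpr n x = 0) ->
      \sum_(n <- p) tpr n x = \sum_(n <- q) tpr n x.
    move=> up pq p0; rewrite -(@fsum_seq _ _ p) // -(@fsum_seq _ _ q) //.
    by move=> n nq; apply: p0; apply: contra nq; exact: pq.
  rewrite {1}st {1}ru (sum_q s) //; last first.
    by move=> n ns; rewrite mem_undup mem_cat ns.
  rewrite (sum_q r) //; last by move=> n nr; rewrite mem_undup mem_cat nr orbT.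
  by rewrite -big_split; apply: eq_bigr => n _ /=; rewrite linearD.
exists [:: a + b]; split=> // [n|].
  by rewrite inE (tprE n hv hw) => /negbTE ->.
by rewrite big_seq1 (tprE _ hv hw) eqxx.
Qed.


Definition tens_gspace : gspace k := GSpace tpr_linear tpr_pr tpr_dec.

(* Opaque, so that only the properties listed in [gtensor] are used. *)
Lemma gtensor_exists : gtensor V W.
Proof.
apply: (@GTensor V W tens_gspace (@tpure k V W) (@tlift k V W)).
- by split; [exact: tpure_linearl|exact: tpure_linearr].
- by move=> a b v w hv hw; rewrite /homog /= (tprE _ hv hw) eqxx.
- exact: tens_ind.
- by move=> X b; exact: tlift_linear.
- by move=> X b; exact: tliftE.
Qed.

Definition gtens : gspace k := gt_car gtensor_exists.
Definition pure (v : V) (w : W) : gtens := gt_pure gtensor_exists v w.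
Definition glift (X : lmodType k) (b : V -> W -> X) : gtens -> X :=
  @gt_lift V W gtensor_exists X b.

Lemma pure_linearl w : linear (pure^~ w).
Proof. exact: (gt_bilin gtensor_exists).1. Qed.
Lemma pure_linearr v : linear (pure v).
Proof. exact: (gt_bilin gtensor_exists).2. Qed.

Definition purel w v := pure v w.
HB.instance Definition _ w :=
  GRing.isLinear.Build k V gtens *:%R (purel w) (pure_linearl w).
HB.instance Definition _ v :=
  GRing.isLinear.Build k W gtens *:%R (pure v) (pure_linearr v).

Lemma pure_suml (I : Type) (s : seq I) (P : pred I) (F : I -> V) w :
  pure (\sum_(j <- s | P j) F j) w = \sum_(j <- s | P j) pure (F j) w.
Proof. exact: (linear_sum (purel w)). Qed.
Lemma pure_sumr (I : Type) (s : seq I) (P : pred I) (F : I -> W) v :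
  pure v (\sum_(j <- s | P j) F j) = \sum_(j <- s | P j) pure v (F j).
Proof. exact: linear_sum. Qed.
Lemma pureZl c v w : pure (c *: v) w = c *: pure v w.
Proof. exact: (linearZZ (purel w)). Qed.
Lemma pureZr c v w : pure v (c *: w) = c *: pure v w.
Proof. exact: linearZZ. Qed.
Lemma pure0l w : pure 0 w = 0. Proof. exact: (linear0 (purel w)). Qed.
Lemma pure0r v : pure v 0 = 0. Proof. exact: linear0. Qed.

Lemma homog_pure a b (v : V) (w : W) :
  homog a v -> homog b w -> homog (a + b) (pure v w).
Proof. exact: gt_homog. Qed.

Lemma gtens_ind (P : gtens -> Prop) :
  P 0 -> (forall s t, P s -> P t -> P (s + t)) ->
  (forall v w, P (pure v w)) -> forall t, P t.
Proof. exact: gt_ind. Qed.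

Lemma gtens_hind (P : gtens -> Prop) :
  P 0 -> (forall s t, P s -> P t -> P (s + t)) ->
  (forall a b v w, homog a v -> homog b w -> P (pure v w)) -> forall t, P t.
Proof.
move=> P0 PD Ph; apply: gtens_ind => // v w.
have [s _ ->] := gpr_dec v; have [r _ ->] := gpr_dec w.
rewrite pure_suml; apply: (big_ind P) => // a _.
rewrite pure_sumr; apply: (big_ind P) => // b _.
by apply: (Ph a b); exact: homog_gpr.
Qed.

Lemma glift_linear (X : lmodType k) (b : V -> W -> X) :
  bilin b -> linear (glift b).
Proof. exact: gt_lift_linear. Qed.

Lemma gliftE (X : lmodType k) (b : V -> W -> X) v w :
  bilin b -> glift b (pure v w) = b v w.
Proof. by move=> bP; exact: gt_liftE. Qed.

Lemma linear_gtens_eq (X : lmodType k) (f g : gtens -> X) :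
  linear f -> linear g -> (forall v w, f (pure v w) = g (pure v w)) -> f =1 g.
Proof.
move=> fl gl fg; have f0 : f 0 = 0.
  by have := fl (-1) 0 0; rewrite scaler0 addr0 scaleN1r addNr.
have g0 : g 0 = 0 by have := gl (-1) 0 0; rewrite scaler0 addr0 scaleN1r addNr.
apply: gtens_ind => [|s t fgs fgt|]; [by rewrite f0 g0| |exact: fg].
by rewrite -[s]scale1r fl gl fgs fgt.
Qed.

Lemma gtens_homog (X : gspace k) e (F : gtens -> X) : linear F ->
  (forall a b (v : V) (w : W), homog a v -> homog b w ->
     homog (a + b + e) (F (pure v w))) ->
  forall n t, homog n t -> homog (n + e) (F t).
Proof.
move=> Flin Fh n t <-; have F0 : F 0 = 0.
  by have := Flin (-1) 0 0; rewrite scaler0 addr0 scaleN1r addNr.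
have FD : {morph F : x y / x + y}.
  by move=> x y; have := Flin 1 x y; rewrite !scale1r.
move: t; apply: gtens_hind => [|s t Hs Ht|a b v w hv hw].
- by rewrite linear0 F0 /homog linear0.
- by move: Hs Ht; rewrite /homog !linearD /= FD linearD /= => -> ->.
rewrite (gpr_homog _ (homog_pure hv hw)); case: eqP => [->|_]; first exact: Fh.
by rewrite F0 /homog linear0.
Qed.
End Space.

Definition kpr (n : int) (c : k^o) : k^o := if n == 0 then c else 0.
Lemma kpr_linear n : linear (kpr n).
Proof. by move=> c x y; rewrite /kpr; case: ifP; rewrite ?scaler0 ?addr0. Qed.
Lemma kpr_pr m n c : kpr m (kpr n c) = if m == n then kpr n c else 0.
Proof.
rewrite /kpr; case: (n =P 0) => [->|] //; rewrite !if_same //.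
Qed.
Lemma kpr_dec c : exists2 s : seq int, uniq s & c = \sum_(n <- s) kpr n c.
Proof. by exists [:: 0]; rewrite // big_seq1. Qed.
Definition gunit : gspace k := GSpace kpr_linear kpr_pr kpr_dec.

Section TensorMap.
Variables (V V' W W' : gspace k) (f : gmap V V') (g : gmap W W').

(* The sign [ksgn (gdeg g)] is the Koszul sign (-1)^(|g||v|), see [tensmE]. *)
Definition tensm_bil (v : V) (w : W) : gtens V' W' :=
  pure (f (ksgn (gdeg g) v)) (g w).
Lemma tensm_bilin : bilin tensm_bil.
Proof.
split=> [w c v v'|v c w w'].
  by rewrite /tensm_bil !linearP; exact: (linearP (purel _)).
by rewrite /tensm_bil !linearP.
Qed.
Lemma tensm_linear : linear (glift tensm_bil).
Proof. exact: glift_linear tensm_bilin. Qed.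

Lemma glift_tensmE a v w : homog a v ->
  glift tensm_bil (pure v w) = (-1) ^ (gdeg g * a) *: pure (f v) (g w).
Proof.
move=> hv; rewrite (gliftE _ _ tensm_bilin) /tensm_bil (ksgnE _ hv).
by rewrite linearZZ pureZl.
Qed.

Lemma tensm_homog n t : homog n t ->
  homog (n + (gdeg f + gdeg g)) (glift tensm_bil t).
Proof.
apply: gtens_homog => [|a b v w hv hw].
  exact: tensm_linear.
rewrite (glift_tensmE _ hv) addrACA /homog linearZZ; congr (_ *: _).
by apply: homog_pure; exact: gfun_homog.
Qed.

Definition tensm : gmap (gtens V W) (gtens V' W') :=
  GMap tensm_linear tensm_homog.

Lemma tensmE a v w : homog a v ->
  tensm (pure v w) = (-1) ^ (gdeg g * a) *: pure (f v) (g w).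
Proof. exact: glift_tensmE. Qed.
End TensorMap.

Section Unitors.
Variable V : gspace k.

Lemma lunit_homog n (v : V) :
  homog n v -> homog (n + 0) (pure (1 : gunit) v).
Proof. by rewrite addrC => hv; apply: homog_pure. Qed.
(* V -> k (x) V *)
Definition lunit_inv : gmap V (gtens gunit V) :=
  GMap (@pure_linearr gunit V (1 : k^o)) lunit_homog.

Definition runit_bil (v : V) (c : gunit) : V := @GRing.scale k V c v.
Lemma runit_bilin : bilin runit_bil.
Proof.
split=> [c a v v'|v a c c']; rewrite /runit_bil.
  by rewrite scalerDr !scalerA mulrC.
by rewrite scalerDl scalerA.
Qed.
Lemma runit_homog n t : @homog k (gtens V gunit) n t ->
  homog (n + 0) (glift runit_bil t).
Proof.
apply: gtens_homog => [|a b v c hv hc]; first exact: glift_linear runit_bilin.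
rewrite (gliftE _ _ runit_bilin) addr0 /runit_bil; move: hc; rewrite /homog /= /kpr.
by case: eqP => [->|_ <-]; rewrite ?scale0r ?linear0 // addr0 linearZZ /= hv.
Qed.
(* V (x) k -> V *)
Definition runit : gmap (gtens V gunit) V :=
  GMap (glift_linear runit_bilin) runit_homog.
End Unitors.

Section Assoc.
Variables U V W : gspace k.

Definition assoc_bil (u : U) : gtens V W -> gtens (gtens U V) W :=
  glift (fun (v : V) (w : W) => pure (pure u v) w).
Lemma assoc_bilin1 (u : U) :
  bilin (fun (v : V) (w : W) => pure (pure u v) w : gtens (gtens U V) W).
Proof.
split=> [w c v v'|v c w w']; last by rewrite linearP.
by rewrite linearP; exact: (linearP (purel _)).
Qed.
Lemma assoc_bilin : bilin assoc_bil.
Proof.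
have Alin u : linear (assoc_bil u) by exact: glift_linear (assoc_bilin1 u).
split=> // t c u u'.
have Rlin : linear (fun t0 => c *: assoc_bil u t0 + assoc_bil u' t0).
  move=> a x y; rewrite !Alin [c *: (_ + _)]scalerDr [a *: (_ + _)]scalerDr.
  by rewrite !scalerA (mulrC c a) addrACA.
apply: (linear_gtens_eq (Alin _) Rlin) => v w.
rewrite /assoc_bil !(gliftE _ _ (assoc_bilin1 _)).
rewrite (pure_linearl v c u u'); exact: (linearP (purel _)).
Qed.
Lemma glift_assocE u v w :
  glift assoc_bil (pure u (pure v w)) = pure (pure u v) w.
Proof.
by rewrite (gliftE _ _ assoc_bilin) /assoc_bil (gliftE _ _ (assoc_bilin1 u)).
Qed.

Lemma assoc_homog n (t : gtens U (gtens V W)) :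
  homog n t -> homog (n + 0) (glift assoc_bil t).
Proof.
apply: gtens_homog => [|a b u s hu <-]; first exact: glift_linear assoc_bilin.
have Ll : linear (assoc_bil u) by exact: assoc_bilin.2.
rewrite (gliftE _ _ assoc_bilin) addr0.
have L0 : assoc_bil u 0 = 0.
  by have := Ll (-1) 0 0; rewrite scaler0 addr0 scaleN1r addNr.
pose F s := assoc_bil u (gpr b s).
rewrite -[assoc_bil _ _]/(F s); move: s.
apply: gtens_hind => [|x y|c d v w hv hw].
- by rewrite /F linear0 L0 /homog linear0.
- rewrite /F linearD /= -[X in assoc_bil u (X + _)]scale1r Ll scale1r.
  by rewrite /homog linearD /= => -> ->.
rewrite /F (gpr_homog _ (homog_pure hv hw)); case: eqP => [->|_].
  rewrite /assoc_bil (gliftE _ _ (assoc_bilin1 u)) addrA.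
  by apply: homog_pure => //; exact: homog_pure.
by rewrite L0 /homog linear0.
Qed.
(* U (x) (V (x) W) -> (U (x) V) (x) W *)
Definition assoc_inv : gmap (gtens U (gtens V W)) (gtens (gtens U V) W) :=
  GMap (glift_linear assoc_bilin) assoc_homog.

Lemma assocE u v w : assoc_inv (pure u (pure v w)) = pure (pure u v) w.
Proof. exact: glift_assocE. Qed.
End Assoc.
End GradedTensor.

Section Homology.
Variables (k : fieldType) (A : gspace k) (d : gmap A A).

Definition is_cycle : {pred A} := fun x => d x == 0.
Lemma is_cycle_submod : submod_closed is_cycle.
Proof.
split=> [|c x y]; rewrite /is_cycle !unfold_in ?linear0 //.
by move=> /eqP dx /eqP dy; rewrite linearP /= dx dy scaler0 addr0.
Qed.
HB.instance Definition _ := GRing.isSubmodClosed.Build k A is_cycle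
  is_cycle_submod.

Record cycle := Cycle { cval : A; cvalP : cval \in is_cycle }.
HB.instance Definition _ := [isSub for cval].
HB.instance Definition _ := [Choice of cycle by <:].
HB.instance Definition _ := [SubChoice_isSubLmodule of cycle by <:].

Definition boundary : set cycle := [set z : cycle | exists x, d x = cval z]%classic.

(* ker d / im d *)
Definition homology_space : lmodType k := lquot boundary.

Lemma cycle_gpr_subproof n (z : cycle) : gpr n (cval z) \in is_cycle.
Proof.
case: z => x /= /eqP dx; rewrite /is_cycle unfold_in -gpr_gfun dx.
by rewrite linear0.
Qed.
Definition cycle_gpr n (z : cycle) : cycle := Cycle (cycle_gpr_subproof n z).

Lemma cval_linear : linear cval. Proof. by []. Qed.
HB.instance Definition _ := GRing.isLinear.Build k cycle A *:%R cval cval_linear.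

Definition class_gpr n (z : cycle) : homology_space := lproj boundary (cycle_gpr n z).
Lemma class_gpr_linear n : linear (class_gpr n).
Proof.
move=> c y z; rewrite /class_gpr -linearP; congr (lproj _ _); apply: val_inj => /=.
by rewrite !linearP.
Qed.
HB.instance Definition _ n :=
  GRing.isLinear.Build k cycle homology_space *:%R (class_gpr n) (class_gpr_linear n).

Lemma class_gpr_boundary n z : boundary z -> class_gpr n z = 0.
Proof.
case=> x dx; rewrite /class_gpr -(linear0 (lproj boundary)).
apply/lproj_eq; rewrite subr0; apply: lin_span_sub.
exists (gpr (n - gdeg d) x) => /=.
by rewrite -gpr_gfun subrK dx.
Qed.

Definition homology_gpr n : homology_space -> homology_space :=
  lquot_lift (class_gpr n).
Lemma homology_gprE n z : homology_gpr n (lproj boundary z) = class_gpr n z.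
Proof. exact: lquot_liftE (@class_gpr_boundary n). Qed.
Lemma homology_gpr_linear n : linear (homology_gpr n).
Proof. exact: lquot_lift_linear (@class_gpr_boundary n). Qed.
Lemma homology_gpr_pr m n q :
  homology_gpr m (homology_gpr n q) = if m == n then homology_gpr n q else 0.
Proof.
have [z <-] := lproj_surj q; rewrite homology_gprE homology_gprE.
case: eqP => [->|/eqP/negbTE mn].
  congr (lproj _ _); apply: val_inj => /=; exact: homog_gpr.
rewrite -(linear0 (lproj boundary)); congr (lproj _ _); apply: val_inj => /=.
by rewrite gpr_pr mn.
Qed.
Lemma homology_gpr_dec q :
  exists2 s : seq int, uniq s & q = \sum_(n <- s) homology_gpr n q.
Proof.
have [z <-] := lproj_surj q; have [s us zE] := gpr_dec (cval z).
exists s => //; under eq_bigr do rewrite homology_gprE.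
rewrite -linear_sum; congr (lproj _ _); apply: val_inj => /=.
by rewrite (linear_sum cval) {1}zE.
Qed.

Definition homology : gspace k :=
  GSpace homology_gpr_linear homology_gpr_pr homology_gpr_dec.
End Homology.

Section TensorPower.
Variable k : fieldType.

(* B_0 (x) (B_1 (x) ( ... (x) (B_(n-1) (x) k))) *)
Fixpoint ntens n : ('I_n -> gspace k) -> gspace k :=
  if n is n'.+1 then
    fun B => gtens (B ord0) (ntens (fun j : 'I_n' => B (fintype.lift ord0 j)))
  else fun=> gunit k.

Fixpoint ntensm n : forall (B C : 'I_n -> gspace k),
    (forall j, gmap (B j) (C j)) -> gmap (ntens B) (ntens C) :=
  if n is n'.+1 then
    fun B C f => tensm (f ord0) (ntensm (fun j : 'I_n' => f (fintype.lift ord0 j)))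
  else fun _ _ _ => gid.

Lemma gdeg_ntensm n (B C : 'I_n -> gspace k) (f : forall j, gmap (B j) (C j)) :
  gdeg (ntensm f) = \sum_j gdeg (f j).
Proof.
by elim: n B C f => [|n IH] B C f /=; rewrite ?big_ord0 // big_ord_recl IH.
Qed.

Definition tpow (A : gspace k) (n : nat) : gspace k := ntens (fun _ : 'I_n => A).

Variable A : gspace k.

Definition tpow1 : gmap (tpow A 1) A := runit A.

Fixpoint tsplit (m n : nat) :
    gmap (tpow A (m + n)) (gtens (tpow A m) (tpow A n)) :=
  if m is m'.+1 then assoc_inv A (tpow A m') (tpow A n) \oc tensm gid (tsplit m' n)
  else lunit_inv (tpow A n).

Definition tcast m n (E : m = n) : gmap (tpow A m) (tpow A n) :=
  let: erefl := E in gid.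

(* For n = a + b, the canonical isomorphism from the n-th tensor power to the
   product of the a-th and the b-th one; the value for n <> a + b is junk. *)
Definition tdeconc (a b n : nat) :
    gmap (tpow A n) (gtens (tpow A a) (tpow A b)) :=
  if n =P (a + b)%N is ReflectT E then tsplit a b \oc tcast E else gzero.

Lemma tdeconcE a b t : tdeconc a b (a + b) t = tsplit a b t.
Proof.
rewrite /tdeconc; case: eqP => // E.
by rewrite (eq_irrelevance E erefl).
Qed.

(* F (x) G as a map on the n-th tensor power, for n = a + b *)
Definition tens_at n a b (V W : gspace k)
    (F : gmap (tpow A a) V) (G : gmap (tpow A b) W) : gmap (tpow A n) (gtens V W) :=
  tensm F G \oc tdeconc a b n.

End TensorPower.

Arguments tens_at {k A} n {a b V W}.

Record dgalg (k : fieldType) := DGAlg {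
  dg_car :> gspace k;
  dg_d : gmap dg_car dg_car;
  dg_mul : gmap (gtens dg_car dg_car) dg_car;
  dg_one : dg_car;
  gdeg_d : gdeg dg_d = -1;
  gdeg_mul : gdeg dg_mul = 0;
  dg_one_homog : homog 0 dg_one;
  dg_mulA : forall a b c,
    dg_mul (pure (dg_mul (pure a b)) c) = dg_mul (pure a (dg_mul (pure b c)));
  dg_mul1l : forall a, dg_mul (pure dg_one a) = a;
  dg_mul1r : forall a, dg_mul (pure a dg_one) = a;
  dg_dd : forall a, dg_d (dg_d a) = 0;
  dg_leibniz : forall t, dg_d (dg_mul t) =
    dg_mul (tensm dg_d gid t + tensm gid dg_d t)
}.

Record defretract (k : fieldType) (A : dgalg k) := DefRetract {
  dr_p : gmap A (homology (dg_d A));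
  dr_i : gmap (homology (dg_d A)) A;
  dr_h : gmap A A;
  gdeg_p : gdeg dr_p = 0;
  gdeg_i : gdeg dr_i = 0;
  gdeg_h : gdeg dr_h = 1;
  dr_pd : forall a, dr_p (dg_d A a) = 0;
  dr_di : forall x, dg_d A (dr_i x) = 0;
  dr_pi : forall x, dr_p (dr_i x) = x;
  dr_homotopy : forall a,
    a - dr_i (dr_p a) = dg_d A (dr_h a) + dr_h (dg_d A a);
  dr_hh : forall a, dr_h (dr_h a) = 0;
  dr_ph : forall a, dr_p (dr_h a) = 0;
  dr_hi : forall x, dr_h (dr_i x) = 0
}.

Section Chi.
Variables (k : fieldType) (A : dgalg k) (R : defretract A).

Local Notation nu := (dg_mul A).
Local Notation h := (dr_h R).

Definition ip : gmap A A := dr_i R \oc dr_p R.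

Lemma gdeg_ip : gdeg ip = 0.
Proof. by rewrite /= gdeg_p gdeg_i addr0. Qed.

(* id^(x r) (x) h (x) (ip)^(x (n - 1 - r)) *)
Definition h_at n (r : 'I_n) : gmap (tpow A n) (tpow A n) :=
  ntensm (fun j : 'I_n => if (j < r)%N then gid else if j == r then h else ip).

Lemma gdeg_h_at n (r : 'I_n) : gdeg (h_at r) = 1.
Proof.
rewrite gdeg_ntensm (bigD1 r) //= ltnn eqxx gdeg_h big1 ?addr0 // => j jr.
by rewrite (negbTE jr); case: ifP => // _; exact: gdeg_ip.
Qed.

Definition h_ n : gmap (tpow A n) (tpow A n) := gsum (@gdeg_h_at n).

(* id^(x r) (x) nu (x) id^(x (m - r)) for r <= m; the value for r > m is junk. *)
Fixpoint nu_at (r m : nat) : gmap (tpow A m.+2) (tpow A m.+1) :=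
  match r, m with
  | 0, m => tensm nu gid \oc assoc_inv A A (tpow A m)
  | r'.+1, m'.+1 => tensm gid (nu_at r' m')
  | r'.+1, 0 => gzero
  end.

Lemma gdeg_nu_at r m : gdeg (nu_at r m) = 0.
Proof.
elim: r m => [|r IH] [|m] //=; rewrite ?gdeg_mul ?addr0 ?add0r //.
Qed.

(* nu_n for n = m + 2 *)
Definition nu_ (m : nat) : gmap (tpow A m.+2) (tpow A m.+1) :=
  @gsum k _ _ 0 m.+1 (fun r => gscale ((-1) ^+ (m - r)) (nu_at r m))
    (fun r => gdeg_nu_at r m).

Fixpoint chi_rec (m : nat) : gmap (tpow A m.+2) A :=
  if m is m'.+1 then
    gscale ((-1) ^+ m'.+2) (chi_rec m' \oc h_ m'.+2 \oc nu_ m'.+1)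
  else nu \oc tensm gid (tpow1 A).

Definition chi (n : nat) : gmap (tpow A n) A :=
  if n is m.+2 then chi_rec m else gzero.

Lemma gdeg_chi n : (2 <= n)%N -> gdeg (chi n) = (n - 2)%N.
Proof.
case: n => [|[|m]] // _; rewrite subn2 /=; elim: m => [|m IH] /=.
  by rewrite gdeg_mul !addr0.
by rewrite IH add0r intS.
Qed.

Inductive i_or_hf : forall B : gspace k, gmap B A -> Prop :=
| Is_i : i_or_hf (dr_i R)
| Is_hf (B : gspace k) (f : gmap B A) : i_or_hf (h \oc f).

End Chi.

(* Main.v *)
(* On a tensor a_1 (x) ... (x) a_n of homogeneous elements killed by h, only the
   summands of h_(n-1) nu_n that apply h to the freshly formed product survive,
   so chi_n(a) = - \sum_r e_1 ... e_r chi_(n-1)(a^r), where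
   a^r = (a_1, ..., a_r, h(a_(r+1) a_(r+2)), ip a_(r+3), ..., ip a_n) and
   e_j = - (-1)^|a_j| is the shifted sign.  All entries of a^r are again killed
   by h, because h^2 = 0 and h i = 0, so induction on n applies to each a^r.  In
   the term with blocks of sizes k and l, merges inside the left block resum to
   the recursion for chi_(k+1), and merges inside the right block vanish since
   p h = 0; the new term k = 2 comes from id (x) h chi_(n-2) at r = 0. *)
Require Import Defs.
From mathcomp Require Import all_boot all_order all_algebra zify.
Local Open Scope ring_scope.

Set Implicit Arguments.
Unset Strict Implicit.
Unset Printing Implicit Defensive.

Import GRing.Theory.

(** * Linearity of graded maps *)

Section GradedMaps.
Variables (k : fieldType) (V W : gspace k) (f : gmap V W).

Lemma gfunP c u v : f (c *: u + v) = c *: f u + f v.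
Proof. exact: gfun_linear. Qed.

Lemma gfunN v : f (- v) = - f v.
Proof. exact: linearN. Qed.

Lemma gfunZ c v : f (c *: v) = c *: f v.
Proof. exact: linearZZ. Qed.

Lemma gfun_sum (I : Type) (s : seq I) (P : pred I) (F : I -> V) :
  f (\sum_(i <- s | P i) F i) = \sum_(i <- s | P i) f (F i).
Proof. exact: linear_sum. Qed.

End GradedMaps.

Lemma gcompE (k : fieldType) (U V W : gspace k) (g : gmap V W) (f : gmap U V) u :
  (g \oc f) u = g (f u).
Proof. by []. Qed.

(** * Pure tensors in tensor powers, and their Koszul signs *)

Section PureTensors.
Variables (k : fieldType) (A : gspace k).

(* Only the entries [a 0, ..., a (n - 1)] matter. *)
Fixpoint ptens (n : nat) (a : nat -> A) : tpow A n :=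
  if n is m.+1 then pure (a 0%N) (ptens m (fun j => a j.+1)) else (1 : k^o).

Lemma eq_ptens n (a b : nat -> A) :
  (forall j, (j < n)%N -> a j = b j) -> ptens n a = ptens n b.
Proof.
elim: n a b => //= n IH a b ab; rewrite (ab 0%N) //; congr (pure _ _).
by apply: IH => j jn; exact: ab.
Qed.

Lemma ptens_eq0 n (a : nat -> A) r : (r < n)%N -> a r = 0 -> ptens n a = 0.
Proof.
elim: n a r => //= n IH a [|r] rn ar; first by rewrite ar pure0l.
by rewrite (IH _ r) // pure0r.
Qed.

(** The Koszul sign of a map of degree 1 moving past the first [r] entries, when [d] lists their
    degrees. *)
Definition sgn (d : nat -> int) r : k := \prod_(j < r) (-1) ^ (d j).

Lemma sgn0 d : sgn d 0 = 1. Proof. exact: big_ord0. Qed.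

Lemma sgnSl d r : sgn d r.+1 = (-1) ^ (d 0%N) * sgn (fun j => d j.+1) r.
Proof. exact: big_ord_recl. Qed.

Lemma sgnE d r : sgn d r = (-1) ^ (\sum_(j < r) d j).
Proof.
elim: r d => [|r IH] d; first by rewrite sgn0 big_ord0.
by rewrite sgnSl IH big_ord_recl exprzDr // unitrN1.
Qed.

Lemma homog_ptens n (a : nat -> A) d : (forall j, homog (d j) (a j)) ->
  homog (\sum_(j < n) d j) (ptens n a).
Proof.
elim: n a d => [|n IH] a d ad; first by rewrite big_ord0.
by rewrite big_ord_recl; apply: homog_pure; last exact: (IH _ (fun j => d j.+1)).
Qed.

Lemma gdeg_tsplit m n : gdeg (tsplit A m n) = 0.
Proof. by elim: m => [|m IH] //=; rewrite IH !addr0. Qed.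

Lemma ksgn0 (V : gspace k) (v : V) : ksgn 0 v = v.
Proof.
move: v; apply: gspace_ind => [|u v Hu Hv|n v hv]; first exact: linear0.
  by rewrite linearD /= Hu Hv.
by rewrite (ksgnE _ hv) mul0r expr0z scale1r.
Qed.

Lemma tensm_deg0 (V V' W W' : gspace k) (f : gmap V V') (g : gmap W W') v w :
  gdeg g = 0 -> tensm f g (pure v w) = pure (f v) (g w).
Proof.
move=> g0; have -> : tensm f g (pure v w) = pure (f (ksgn (gdeg g) v)) (g w).
  exact: gliftE (tensm_bilin f g).
by rewrite g0 ksgn0.
Qed.

Lemma tsplit_ptens m n (a : nat -> A) :
  tsplit A m n (ptens (m + n) a) = pure (ptens m a) (ptens n (fun j => a (m + j)%N)).
Proof.
elim: m a => [|m IH] a //.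
rewrite -[LHS]/(assoc_inv A (tpow A m) (tpow A n)
  (tensm gid (tsplit A m n) (pure (a 0%N) (ptens (m + n) (fun j => a j.+1))))).
by rewrite (tensm_deg0 _ _ _ (gdeg_tsplit m n)) IH assocE.
Qed.

(** The sign comes from [G] moving past [ptens m a], which is homogeneous of degree the sum of the
    first [m] values of [d]. *)
Lemma tens_at_ptens n m l (V W : gspace k) (F : gmap (tpow A m) V)
    (G : gmap (tpow A l) W) a d :
  (m + l)%N = n -> (forall j, homog (d j) (a j)) ->
  tens_at n F G (ptens n a) =
    sgn d m ^ gdeg G *: pure (F (ptens m a)) (G (ptens l (fun j => a (m + j)%N))).
Proof.
move=> <- ad; rewrite -[LHS]/(tensm F G (tdeconc A m l (m + l) (ptens (m + l) a))).
rewrite tdeconcE tsplit_ptens.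
by rewrite (tensmE _ _ _ (homog_ptens _ ad)) sgnE exprz_exp mulrC.
Qed.

Lemma tpow1_ptens a : tpow1 A (ptens 1 a) = a 0%N.
Proof.
rewrite /tpow1 /= (gliftE _ _ (@runit_bilin k A)) /runit_bil.
exact: scale1r.
Qed.

Lemma ntensm_deg0 n (F : nat -> gmap A A) a :
  (forall j, gdeg (F j) = 0) ->
  ntensm (fun j : 'I_n => F j) (ptens n a) = ptens n (fun j => F j (a j)).
Proof.
move=> F0; elim: n F F0 a => [|n IH] F F0 a //.
rewrite -[LHS]/(tensm (F 0%N) (ntensm (fun j : 'I_n => F j.+1))
  (pure (a 0%N) (ptens n (fun j => a j.+1)))).
rewrite tensm_deg0; last by rewrite gdeg_ntensm big1.
by congr (pure _ _); exact: (IH (fun j => F j.+1) _ (fun j => a j.+1)).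
Qed.

(** The image of a tensor product of maps is spanned by pure tensors of homogeneous values of the
    factors. With [K] the kernel of [h], this reduces the theorem to pure tensors. *)
Lemma ntensm_span_ind n (B : 'I_n -> gspace k) (f : forall j, gmap (B j) A)
    (K : A -> Prop) (P : tpow A n -> Prop) :
  (forall j v, K (f j v)) -> K 0 ->
  (forall c s t, P s -> P t -> P (c *: s + t)) ->
  (forall a d, (forall j, homog (d j) (a j)) -> (forall j, K (a j)) ->
     P (ptens n a)) ->
  forall x, P (ntensm f x).
Proof.
move=> Kf K0; elim: n B f Kf P => [|n IH] B f Kf P PL Pp x.
all: have P0 : P 0.
1,3: have P1 : P (ptens _ (fun=> 0)) by apply: (Pp _ (fun=> 0)) => // _; exact: linear0.
1,2: by have := PL (-1) _ _ P1 P1; rewrite scaleN1r addNr.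
  (* The zeroth power is the field, where [x] is [x] times the empty pure tensor [1]. *)
  rewrite -[ntensm f x]addr0 -[ntensm f x]/(x : k^o) -[x]mulr1.
  apply: PL => //; apply: (Pp (fun=> 0) (fun=> 0)) => // _; exact: linear0.
rewrite -[ntensm f x]/(tensm (f ord0)
  (ntensm (fun j : 'I_n => f (fintype.lift ord0 j))) x).
move: x; apply: gtens_hind => [|s t Ps Pt|a b v w hv hw].
- by rewrite linear0.
- by rewrite linearD -[X in X + _]scale1r; exact: PL.
(* The Koszul sign is absorbed into the first entry [u], still a value of [f ord0]; with [u] fixed,
   induction treats the remaining factors. *)
rewrite (tensmE _ _ _ hv) -pureZl.
set u := _ *: _.
have Ku : K u by rewrite /u -linearZZ; exact: Kf.
have hu : homog (a + gdeg (f ord0)) u.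
  by rewrite /homog linearZZ; congr (_ *: _); exact: gfun_homog.
pose Q t := P (pure u t).
rewrite -[P _]/(Q _); apply: (IH _ _ _ Q).
- by move=> j; exact: Kf.
- by move=> c s t Qs Qt; rewrite /Q pure_linearr; exact: PL.
move=> a' d' ad' Ka'.
by apply: (Pp (fun j => if j is i.+1 then a' i else u)
   (fun j => if j is i.+1 then d' i else a + gdeg (f ord0))); case.
Qed.

End PureTensors.

(** * The recursion for [chi] on pure tensors with entries killed by [h] *)

Section Recursion.
Variables (k : fieldType) (A : dgalg k) (R : defretract A).

Local Notation h := (dr_h R).
Local Notation ip := (ip R).
Local Notation chi := (chi R).

Definition mu (x y : A) : A := dg_mul A (pure x y).

Lemma mu_sumr (I : Type) (r : seq I) (P : pred I) (F : I -> A) x :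
  mu x (\sum_(i <- r | P i) F i) = \sum_(i <- r | P i) mu x (F i).
Proof. by rewrite /mu pure_sumr linear_sum. Qed.

Lemma mu_suml (I : Type) (r : seq I) (P : pred I) (F : I -> A) x :
  mu (\sum_(i <- r | P i) F i) x = \sum_(i <- r | P i) mu (F i) x.
Proof. by rewrite /mu pure_suml linear_sum. Qed.

Lemma muZl c x y : mu (c *: x) y = c *: mu x y.
Proof. by rewrite /mu pureZl linearZZ. Qed.

Lemma muZr c x y : mu x (c *: y) = c *: mu x y.
Proof. by rewrite /mu pureZr linearZZ. Qed.

Lemma mu0r x : mu x 0 = 0. Proof. by rewrite /mu pure0r linear0. Qed.

Lemma homog_mu m n x y : homog m x -> homog n y -> homog (m + n) (mu x y).
Proof.
move=> hx hy; have := gfun_homog (dg_mul A) (homog_pure hx hy).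
by rewrite gdeg_mul addr0.
Qed.

Lemma homog_h n x : homog n x -> homog (n + 1) (h x).
Proof. by move=> /(gfun_homog h); rewrite gdeg_h. Qed.

Lemma homog_ip n x : homog n x -> homog n (ip x).
Proof. by move=> /(gfun_homog ip); rewrite gdeg_ip addr0. Qed.

Lemma h_ip x : h (ip x) = 0. Proof. exact: dr_hi. Qed.

Lemma ip_h x : ip (h x) = 0.
Proof. by rewrite -[LHS]/(dr_i R (dr_p R (h x))) dr_ph linear0. Qed.

Lemma ip_ip x : ip (ip x) = ip x.
Proof. by rewrite -[LHS]/(dr_i R (dr_p R (dr_i R (dr_p R x)))) dr_pi. Qed.

(** [T] is arbitrary so that the same operation acts on entries and on their degrees. *)
Definition contract (T : Type) r (u : T) (a : nat -> T) j : T :=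
  if (j < r)%N then a j else if j == r then u else a j.+1.

(* The tensor a^r above, with indices starting at 0. *)
Definition merge r (a : nat -> A) j : A :=
  if (j < r)%N then a j else
  if j == r then h (mu (a r) (a r.+1)) else ip (a j.+1).

Lemma nu_at_ptens r m a : (r <= m)%N ->
  nu_at A r m (ptens m.+2 a) = ptens m.+1 (contract r (mu (a r) (a r.+1)) a).
Proof.
elim: r m a => [|r IH] m a rm.
  rewrite -[LHS]/(tensm (dg_mul A) gid (assoc_inv A A (tpow A m)
    (pure (a 0%N) (pure (a 1%N) (ptens m (fun j => a j.+2)))))).
  by rewrite assocE tensm_deg0.
case: m rm => // m rm.
rewrite -[LHS]/(tensm gid (nu_at A r m)
  (pure (a 0%N) (ptens m.+2 (fun j => a j.+1)))).
rewrite tensm_deg0; last exact: gdeg_nu_at.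
by rewrite (IH _ (fun j => a j.+1)).
Qed.

(** The factors of [h_at], indexed by [nat] so that inductions can shift both indices. *)
Definition h_factor r j : gmap A A :=
  if (j < r)%N then gid else if j == r then h else ip.

(** The only factor of nonzero degree is [h], and it moves past the first [r] entries. *)
Lemma h_at_ptens n r b d : (r < n)%N -> (forall j, homog (d j) (b j)) ->
  ntensm (fun j : 'I_n => h_factor r j) (ptens n b) =
  sgn k d r *: ptens n (fun j => h_factor r j (b j)).
Proof.
elim: n r b d => // n IH r b d rn bd.
rewrite -[LHS]/(tensm (h_factor r 0%N) (ntensm (fun j : 'I_n => h_factor r j.+1))
  (pure (b 0%N) (ptens n (fun j => b j.+1)))).
case: r rn => [|r] rn.
  rewrite sgn0 scale1r tensm_deg0; last first.
    by rewrite gdeg_ntensm big1 // => j _; exact: gdeg_ip.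
  congr (pure _ _); apply: (@ntensm_deg0 k A n (fun=> ip)) => j; exact: gdeg_ip.
rewrite (tensmE _ _ _ (bd 0%N)) sgnSl -scalerA.
have -> : gdeg (ntensm (fun j : 'I_n => h_factor r.+1 j.+1)) = 1.
  exact: (gdeg_h_at R (Ordinal (rn : (r < n)%N))).
rewrite mul1r; congr (_ *: _).
rewrite (IH r (fun j => b j.+1) (fun j => d j.+1)) //.
by rewrite linearZZ.
Qed.

(** The Koszul sign after raising every degree by one: the product of the shifted signs e_j. *)
Definition shsgn (d : nat -> int) r : k := \prod_(j < r) - (-1) ^ (d j).

Lemma shsgn0 d : shsgn d 0 = 1. Proof. exact: big_ord0. Qed.

Lemma shsgnSl d r : shsgn d r.+1 = - (-1) ^ (d 0%N) * shsgn (fun j => d j.+1) r.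
Proof. exact: big_ord_recl. Qed.

Lemma shsgnE d r : shsgn d r = (-1) ^+ r * sgn k d r.
Proof.
elim: r d => [|r IH] d; first by rewrite shsgn0 sgn0 mulr1.
by rewrite shsgnSl sgnSl IH exprS mulN1r !mulNr mulrCA.
Qed.

Definition homog_ker_h (d : nat -> int) (a : nat -> A) :=
  forall j, homog (d j) (a j) /\ h (a j) = 0.

Lemma h_nu_ptens r n a d : (r < n.+1)%N -> homog_ker_h d a ->
  h_ R n.+1 (ptens n.+1 (contract r (mu (a r) (a r.+1)) a)) =
  sgn k d r *: ptens n.+1 (merge r a).
Proof.
move=> rn ad; set b := contract _ _ _.
have bd j : homog (contract r (d r + d r.+1) d j) (b j).
  rewrite /b /contract; case: ifP => _; first exact: (ad j).1.
  by case: ifP => _; [apply: homog_mu; exact: (ad _).1|exact: (ad j.+1).1].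
have h_atE (s : 'I_n.+1) : h_at R s (ptens n.+1 b) =
    sgn k (contract r (d r + d r.+1) d) s *: ptens n.+1 (fun j => h_factor s j (b j)).
  exact: (h_at_ptens (ltn_ord s) bd).
rewrite -[LHS]/(\sum_(s < n.+1) h_at R s (ptens n.+1 b)).
(* For [s] other than [r], the factor [h] falls on an original entry of [a] and kills it. *)
rewrite (bigD1 (Ordinal rn)) // big1 => [|s sr]; last first.
  rewrite h_atE (ptens_eq0 (ltn_ord s)) ?scaler0 //.
  rewrite /h_factor ltnn eqxx /b /contract.
  case: ifP => _; first exact: (ad s).2.
  case: ifP => [sr'|_]; last exact: (ad _).2.
  by case/eqP: sr; apply: val_inj; apply/eqP.
apply: etrans (addr0 _) _; rewrite h_atE; congr (_ *: _).
  by apply: eq_bigr => j _; rewrite /contract ltn_ord.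
apply: eq_ptens => j _; rewrite /h_factor /b /contract /merge.
by case: ifP => // _; case: ifP.
Qed.

Lemma chi_ptens m a d : homog_ker_h d a ->
  chi m.+3 (ptens m.+3 a) =
  - \sum_(r < m.+2) shsgn d r *: chi m.+2 (ptens m.+2 (merge r a)).
Proof.
move=> ad.
rewrite -[LHS]/((-1) ^+ m.+2 *: chi m.+2 (h_ R m.+2
  (\sum_(r < m.+2) (-1) ^+ (m.+1 - r) *: nu_at A r m.+1 (ptens m.+3 a)))).
rewrite (gfun_sum (h_ R m.+2)) (gfun_sum (chi m.+2)) scaler_sumr -sumrN.
apply: eq_bigr => r _.
rewrite nu_at_ptens; last by rewrite -ltnS; exact: ltn_ord.
rewrite gfunZ (h_nu_ptens (ltn_ord r) ad) !gfunZ !scalerA shsgnE -scaleNr.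
rewrite mulrA -mulNr -exprD; congr (_ * _ *: _).
(* The signs of [chi] and [nu_] multiply to $(-1)^{r+1}$: one factor $-1$ is the overall sign, and
   $(-1)^r$ has turned [sgn] into [shsgn]. *)
have -> : (m.+2 + (m.+1 - r) = (m.+1 - r).*2 + r.+1)%N.
  by rewrite -addnn -addnA [in RHS]addnS subnK -1?ltnS // addnC addnS.
by rewrite exprD -mul2n exprM sqrrN !expr1n mul1r exprS mulN1r.
Qed.

Definition hchi n a : A := h (chi n (ptens n a)).

Lemma eq_hchi n a b : (forall j, (j < n)%N -> a j = b j) -> hchi n a = hchi n b.
Proof. by move=> ab; rewrite /hchi (eq_ptens ab). Qed.

Lemma hchi_eq0 n a r : (r < n)%N -> a r = 0 -> hchi n a = 0.
Proof. by move=> rn ar; rewrite /hchi (ptens_eq0 rn ar) !linear0. Qed.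

Lemma chi2E a : chi 2 (ptens 2 a) = mu (a 0%N) (a 1%N).
Proof.
rewrite -[LHS]/(dg_mul A (tensm gid (tpow1 A)
  (pure (a 0%N) (ptens 1 (fun j => a j.+1))))).
by rewrite tensm_deg0 // tpow1_ptens.
Qed.

Lemma hchi_rec m a d : homog_ker_h d a ->
  hchi m.+3 a = - \sum_(r < m.+2) shsgn d r *: hchi m.+2 (merge r a).
Proof.
move=> ad; rewrite {1}/hchi (chi_ptens _ ad) gfunN gfun_sum.
by congr (- _); apply: eq_bigr => r _; rewrite gfunZ.
Qed.

Lemma ip_merge_eq r a : ip (merge r a r) = 0.
Proof. by rewrite /merge ltnn eqxx ip_h. Qed.

Lemma ip_merge_gt r a j : (r < j)%N -> ip (merge r a j) = ip (a j.+1).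
Proof. by move=> rj; rewrite /merge ltnNge (ltnW rj) (gtn_eqF rj); exact: ip_ip. Qed.

(** The degrees of the entries of [merge r a]; the [+ 1] is the degree of [h]. *)
Definition dmerge r (d : nat -> int) : nat -> int :=
  contract r (d r + d r.+1 + 1) d.

Lemma homog_ker_h_merge r a d : homog_ker_h d a -> homog_ker_h (dmerge r d) (merge r a).
Proof.
move=> ad j; rewrite /dmerge /contract /merge; case: ifP => _; first exact: ad.
case: ifP => _; split.
- by apply/homog_h/homog_mu; exact: (ad _).1.
- exact: dr_hh.
- by apply/homog_ip; exact: (ad _).1.
- exact: h_ip.
Qed.

(* h(x y) has degree |x| + |y| + 1, so the shifted signs - (-1)^|x|
   are multiplicative under merging. *)
Lemma shsgn_dmerge r n d : (r < n)%N -> shsgn (dmerge r d) n = shsgn d n.+1.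
Proof.
elim: n r d => // n IH [|r] d rn; rewrite shsgnSl.
  rewrite 2![in RHS]shsgnSl mulrA; congr (_ * _).
  by rewrite /dmerge /contract /= !exprzDr ?unitrN1 // expr1z mulrN1 opprK mulrNN.
rewrite [in RHS]shsgnSl; congr (_ * _).
exact: (IH r (fun j => d j.+1)).
Qed.

(** The blocks have sizes [i.+2] and [(N - i).+1], and the exponent [N - i] is the degree of
    [h \oc chi (N - i).+1]. Induction on [N] applies the formula to every [merge r a]. *)
Lemma chi_split N a d : homog_ker_h d a ->
  chi N.+3 (ptens N.+3 a) =
    \sum_(i < N) shsgn d i.+2 ^+ (N - i) *:
       mu (hchi i.+2 a) (hchi (N - i).+1 (fun j => ip (a (i.+2 + j)%N)))
    - shsgn d 1 ^+ N.+1 *: mu (a 0%N) (hchi N.+2 (fun j => a j.+1))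
    - mu (hchi N.+2 a) (ip (a N.+2)).
Proof.
elim: N a d => [|N IH] a d ad; rewrite (chi_ptens _ ad).
  rewrite big_ord0 sub0r !big_ord_recl big_ord0 addr0 shsgn0 scale1r !chi2E expr1.
  by rewrite opprD addrC /hchi !chi2E.
pose T i := shsgn d i.+2 ^+ (N.+1 - i) *:
  mu (hchi i.+2 a) (hchi (N.+1 - i).+1 (fun j => ip (a (i.+2 + j)%N))).
under eq_bigr => r _ do rewrite (IH _ _ (homog_ker_h_merge r ad)) !scalerBr scaler_sumr.
rewrite !sumrB exchange_big.
(* Merges with [r < i.+2] lie in the left block, which then covers [i.+3] entries of [a]; this
   shifts the index of [T] by one. *)
have E1 (i : 'I_N) : \sum_(r < N.+3) shsgn d r *: (shsgn (dmerge r d) i.+2 ^+ (N - i) *: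
      mu (hchi i.+2 (merge r a))
         (hchi (N - i).+1 (fun j => ip (merge r a (i.+2 + j)%N)))) = - T i.+1.
  rewrite /T subSS (hchi_rec _ ad) -sumrN mu_suml scaler_sumr -sumrN.
  rewrite [RHS](big_ord_widen N.+3 (fun r => - (shsgn d i.+3 ^+ (N - i) *:
    mu (- (shsgn d r *: hchi i.+2 (merge r a)))
       (hchi (N - i).+1 (fun j => ip (a (i.+3 + j)%N)))))); last first.
    by have := ltn_ord i; lia.
  rewrite [RHS]big_mkcond; apply: eq_bigr => r _.
  case: ltnP => ri.
    rewrite shsgn_dmerge // -!scaleNr muZl !scalerA mulrNN mulrC.
    congr (_ *: mu _ _); apply: eq_hchi => j _.
    by rewrite ip_merge_gt //; lia.
  (* The merged entry sits at position [r - i.+2] of the right block, where [ip] kills it. *)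
  rewrite (@hchi_eq0 (N - i).+1 _ (r - i.+2)) ?mu0r ?scaler0 //.
    by have := ltn_ord r; have := ltn_ord i; lia.
  by rewrite subnKC // ip_merge_eq.
under eq_bigr => i _ do rewrite E1.
(* The merge at [r = 0] turns the first entry into [hchi 2 a], giving the missing term [T 0]; the
   others resum to the recursion for the tail of [a]. *)
have E2 : \sum_(r < N.+3) shsgn d r *: (shsgn (dmerge r d) 1 ^+ N.+1 *:
      mu (merge r a 0%N) (hchi N.+2 (fun j => merge r a j.+1))) =
    T 0%N - shsgn d 1 ^+ N.+2 *: mu (a 0%N) (hchi N.+3 (fun j => a j.+1)).
  rewrite big_ord_recl shsgn0 scale1r shsgn_dmerge // /T subn0.
  rewrite -[hchi 2 a]/(h (chi 2 (ptens 2 a))) chi2E.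
  congr (_ + _).
  rewrite (hchi_rec _ (fun j => ad j.+1)) -sumrN mu_sumr scaler_sumr -sumrN.
  apply: eq_bigr => r _; rewrite -!scaleNr muZr !scalerA mulrNN.
  have -> : shsgn (dmerge r.+1 d) 1 = shsgn d 1 by rewrite /shsgn !big_ord1.
  rewrite -[shsgn d (lift ord0 r)]/(shsgn d r.+1).
  have -> : shsgn d r.+1 = shsgn d 1 * shsgn (fun j => d j.+1) r.
    by rewrite shsgnSl /shsgn big_ord1.
  by rewrite mulrAC -exprS.
rewrite E2.
(* The last merge is killed by [ip]; the others resum to the recursion for [hchi N.+3 a]. *)
have E3 : \sum_(r < N.+3) shsgn d r *: mu (hchi N.+2 (merge r a)) (ip (merge r a N.+2))
    = - mu (hchi N.+3 a) (ip (a N.+3)).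
  rewrite big_ord_recr ip_merge_eq mu0r scaler0; apply: etrans (addr0 _) _.
  rewrite (hchi_rec _ ad) -sumrN mu_suml -sumrN; apply: eq_bigr => r _.
  by rewrite -scaleNr muZl -scaleNr opprK ip_merge_gt //; exact: (ltn_ord r).
rewrite E3 [in RHS]big_ord_recl -[X in - (X - _ - _)]/(\sum_(i < N) - T i.+1).
rewrite sumrN !opprD !opprK addrA; congr (_ - _ - _).
exact: addrC.
Qed.

(** * Passage to the indexing and the signs of the theorem *)

Lemma sum_antidiag (V : nmodType) N (G : nat -> nat -> V) :
  \sum_(a < N.+4) \sum_(b < N.+4 | [&& (a + b == N.+3)%N, (2 <= a)%N & (2 <= b)%N])
    G a b = \sum_(i < N) G i.+2 (N - i).+1.
Proof.
rewrite big_ord_recl big1 => [|b /and3P[] //]; rewrite add0r.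
rewrite big_ord_recl big1 => [|b /and3P[] //]; rewrite add0r.
(* The two top rows are empty because they leave less than 2 for [b]. *)
have Z a : (N.+1 < a)%N -> \sum_(b < N.+4 | [&& (a + b == N.+3)%N, (2 <= a)%N
    & (2 <= b)%N]) G a b = 0.
  by move=> aN; apply: big1 => b /and3P[/eqP E _ b2]; exfalso; lia.
rewrite 2!big_ord_recr /= !Z ?addr0 //.
apply: eq_bigr => i _; have iN := ltn_ord i.
have lt : ((N - i).+1 < N.+4)%N by lia.
rewrite (big_pred1 (Ordinal lt)) // => b.
rewrite /= -val_eqE /= /bump /=; lia.
Qed.

Lemma chi_split_tens_at N a d : homog_ker_h d a ->
  chi N.+3 (ptens N.+3 a) =
    \sum_(u < N.+4) \sum_(v < N.+4 | [&& (u + v == N.+3)%N, (2 <= u)%N & (2 <= v)%N])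
       (-1) ^+ (u * (v + 1)) *:
       dg_mul A (tens_at N.+3 (h \oc chi u)
         (h \oc chi v \oc ntensm (fun _ : 'I_v => ip)) (ptens N.+3 a))
    + (-1) ^+ (N.+3 - 1) *:
      dg_mul A (tens_at N.+3 (tpow1 A) (h \oc chi N.+2) (ptens N.+3 a))
    - dg_mul A (tens_at N.+3 (h \oc chi N.+2) (ip \oc tpow1 A) (ptens N.+3 a)).
Proof.
move=> ad; have hd j : homog (d j) (a j) := (ad j).1.
rewrite (chi_split _ ad).
rewrite (sum_antidiag N (fun u v => (-1) ^+ (u * (v + 1)) *:
  dg_mul A (tens_at N.+3 (h \oc chi u)
         (h \oc chi v \oc ntensm (fun _ : 'I_v => ip)) (ptens N.+3 a)))).
congr (_ + _ - _).
- apply: eq_bigr => i _; have iN := ltn_ord i.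
  rewrite (@tens_at_ptens _ _ _ _ _ _ _ _ _ a d) //; last by lia.
  rewrite (gcompE h (chi i.+2)) (gcompE (h \oc chi (N - i).+1)) gcompE.
  rewrite (@ntensm_deg0 _ _ _ (fun=> ip)); last by move=> _; exact: gdeg_ip.
  have -> : gdeg (h \oc chi (N - i).+1 \oc ntensm (fun _ : 'I_(N - i).+1 => ip))
      = (N - i)%N.
    rewrite -[LHS]/(gdeg (ntensm (fun _ : 'I_(N - i).+1 => ip)) +
      (gdeg (chi (N - i).+1) + gdeg h)).
    rewrite gdeg_ntensm big1 => [|j _]; last exact: gdeg_ip.
    rewrite gdeg_chi ?gdeg_h ?add0r; last by lia.
    by rewrite subSS -PoszD; congr Posz; lia.
  rewrite gfunZ scalerA; congr (_ *: _).
  rewrite shsgnE exprMn -exprM; congr (_ * _).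
  (* For block sizes k and l, k(l+1) and k(l-1) have the same parity, and $(-1)^{k(l-1)}$ is what
     turns the Koszul sign [sgn] into [shsgn], each to the power l-1. *)
  have -> : (i.+2 * ((N - i).+1 + 1) = i.+2 * (N - i) + i.+2 * 2)%N by lia.
  by rewrite exprD [X in _ = _ * X]exprM sqrr_sign mulr1.
- rewrite (@tens_at_ptens _ _ _ _ _ _ _ _ _ a d) // tpow1_ptens.
  rewrite (gcompE h (chi N.+2)).
  rewrite -[gdeg (h \oc chi N.+2)]/(gdeg (chi N.+2) + gdeg h) gdeg_chi // gdeg_h.
  rewrite gfunZ scalerA -scaleNr; congr (_ *: _).
  rewrite shsgnE exprMn -PoszD !subSS !subn0 addn1.
  by rewrite expr1 -mulNr -mulN1r -exprS.
rewrite (@tens_at_ptens _ _ _ _ _ _ _ _ _ a d) //; last by lia.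
have -> : gdeg (ip \oc tpow1 A) = 0 by rewrite /= gdeg_p gdeg_i !addr0.
by rewrite expr0z scale1r (gcompE h (chi N.+2)) (gcompE ip) tpow1_ptens addn0.
Qed.

(** * Reduction of the theorem to pure tensors *)

Lemma i_or_hf_h (B : gspace k) (f : gmap B A) v : i_or_hf R f -> h (f v) = 0.
Proof. by move=> Hf; case: Hf v => [|B' f'] v; [exact: dr_hi|exact: dr_hh]. Qed.

End Recursion.

Theorem proposition7p1 (k : fieldType) (A : dgalg k) (R : defretract A)
    (n : nat) (hn : (3 <= n)%N)
    (B : 'I_n -> gspace k) (f : forall j : 'I_n, gmap (B j) A)
    (hf : forall j : 'I_n, i_or_hf R (f j)) (x : ntens B) :
  let nu := dg_mul A in
  let h := dr_h R in
  let chi := chi R in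
  let y : tpow A n := ntensm f x in
  chi n y =
    \sum_(a < n.+1) \sum_(b < n.+1 | [&& (a + b == n)%N, (2 <= a)%N & (2 <= b)%N])
       (-1) ^+ (a * (b + 1)) *:
       nu (tens_at n (h \oc chi a)
                     (h \oc chi b \oc ntensm (fun _ : 'I_b => ip R)) y)
    + (-1) ^+ (n - 1) *: nu (tens_at n (tpow1 A) (h \oc chi n.-1) y)
    - nu (tens_at n (h \oc chi n.-1) (ip R \oc tpow1 A) y).
Proof.
move=> nu h chi y; rewrite {}/y; pattern (ntensm f x).
refine (@ntensm_span_ind k A n B f (fun v => h v = 0) _ _ _ _ _ x)
  => [j v||c s t Ps Pt|a d ad ha].
- exact: i_or_hf_h (hf j).
- exact: linear0.
(* Both sides are linear in [y]; the double sum is named so that its linearity can be shown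
   separately. *)
- pose D y := \sum_(a < n.+1)
    \sum_(b < n.+1 | [&& (a + b == n)%N, (2 <= a)%N & (2 <= b)%N])
      (-1) ^+ (a * (b + 1)) *: nu (tens_at n (h \oc chi a)
        (h \oc chi b \oc ntensm (fun _ : 'I_b => ip R)) y).
  have DP : D (c *: s + t) = c *: D s + D t.
    rewrite /D scaler_sumr -big_split; apply: eq_bigr => a _.
    rewrite scaler_sumr -big_split; apply: eq_bigr => b _.
    by rewrite !gfunP scalerDr !scalerA [_ * c]mulrC.
  rewrite gfunP Ps Pt -!/(D _) DP !(gfunP (tens_at _ _ _)) !(gfunP nu).
  rewrite !scalerBr !scalerDr opprD [in RHS]scalerA [_ * c]mulrC -scalerA.
  by rewrite [LHS]addrACA [X in X + _ = _]addrACA.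
case: n hn {B f hf x} => [|[|[|N]]] // _.
by apply: (@chi_split_tens_at _ _ _ _ _ d) => j; split.
Qed.
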